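(* Let $G/P$ be cominuscule and $\lambda\in\mathbb{Y}_{G/P}$. Then $\mathrm{evac}:\mathrm{SYT}_{G/P}(\lambda)\to\mathrm{SYT}_{G/P}(\lambda)$ is an involution, i.e. $\mathrm{evac}(\mathrm{evac}(T))=T$ for all $T\in\mathrm{SYT}_{G/P}(\lambda)$.
   Context: $G$ is a complex connected reductive Lie group with root system $\Phi$, positive roots $\Phi^+$, simple roots $\Delta$; $P$ is a maximal parabolic subgroup associated to a simple root $\beta(P)$ that is cominuscule, i.e. if $\beta(P)$ occurs in the simple root expansion of $\gamma\in\Phi^+$ it does so with coefficient one. Then $G/P$ is called cominuscule. Order $\Phi^+$ by the transitive closure of the covering relations $\alpha\prec\gamma$ if $\gamma-\alpha\in\Delta$. Let $\Lambda_{G/P}\subseteq\Phi^+$ be the subposet of positive roots containing $\beta(P)$ in their simple root expansion (its unique minimal element is $\beta(P)$); its elements are called boxes. Straight shapes are the lower order ideals of $\Lambda_{G/P}$; their set is $\mathbb{Y}_{G/P}$. For $\lambda\subseteq\nu$ in $\mathbb{Y}_{G/P}$, $\nu/\lambda$ is the set difference (skew shape). A standard tableau of shape $\nu/\lambda$ is a bijection $\mathrm{label}:\nu/\lambda\to\{1,\dots,|\nu/\lambda|\}$ with $\mathrm{label}(x)<\mathrm{label}(y)$ whenever $x\prec y$; their set is $\mathrm{SYT}_{G/P}(\nu/\lambda)$, and $\mathrm{SYT}_{G/P}(\lambda)=\mathrm{SYT}_{G/P}(\lambda/\emptyset)$. The jeu de taquin slide $\mathrm{jdt}_x(T)$ of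 a tableau $T$ of shape $\nu/\lambda$ into a box $x\in\lambda$ that is maximal subject to being below some box of $\nu/\lambda$: let $y$ be the box of $\nu/\lambda$ with smallest label among those covering $x$; move $\mathrm{label}(y)$ to $x$, leaving $y$ vacant; then move into $y$ the smallest label among the boxes of $\nu/\lambda$ covering $y$; repeat until no further move is possible. Evacuation. For $T$ of nonempty straight shape, let $\widetilde T$ be obtained by erasing the entry $1$ of $T$ (in box $\beta(P)$) and subtracting $1$ from the remaining entries, and let $\Delta(T)=\mathrm{jdt}_{\beta(P)}(\widetilde T)$ (the empty tableau if $T$ has one box). For $T\in\mathrm{SYT}_{G/P}(\lambda)$, $\mathrm{evac}(T)\in\mathrm{SYT}_{G/P}(\lambda)$ is the tableau defined by the chain of straight shapes $$\emptyset=\mathrm{shape}(\Delta^{|\lambda|}(T))\subset\mathrm{shape}(\Delta^{|\lambda|-1}(T))\subset\cdots\subset\mathrm{shape}(\Delta^1(T))\subset\mathrm{shape}(T)=\lambda,$$ i.e. the label $k$ is placed in the unique box of $\mathrm{shape}(\Delta^{|\lambda|-k}(T))$ not in $\mathrm{shape}(\Delta^{|\lambda|-k+1}(T))$. *)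

(* Defs.v *)
From HB Require Import structures.
From mathcomp Require Import all_boot all_order all_algebra.
From mathcomp Require Import finmap.

Set Implicit Arguments.
Unset Strict Implicit.
Unset Printing Implicit Defensive.

Import Order.TTheory GRing.Theory Num.Theory.
Local Open Scope ring_scope.
Local Open Scope fset_scope.

(** The group [G] enters only through its roots.  Complex connected reductive
    groups are classified up to isomorphism by reduced root data; a choice of
    basis identifies the character lattice with [Z^n] and the cocharacter
    lattice with its dual [Z^n]. *)

Definition pairing n (x y : 'rV[int]_n) : int := \sum_i x 0 i * y 0 i.

(** [coroot] is only meaningful on [roots]. *)
Record root_datum (n : nat) := RootDatum {
  roots : {fset 'rV[int]_n};
  coroot : 'rV[int]_n -> 'rV[int]_n;
  coroot_inj : {in roots &, injective coroot};
  pairing_coroot : forall a, a \in roots -> pairing a (coroot a) = 2;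
  reflection_roots : forall a g, a \in roots -> g \in roots ->
    g - pairing g (coroot a) *: a \in roots;
  reflection_coroots : forall a g, a \in roots -> g \in roots ->
    coroot g - pairing a (coroot g) *: coroot a
      \in [fset coroot d | d in roots];
  roots_reduced : forall (a g : 'rV[int]_n) (k l : int),
    a \in roots -> g \in roots -> l != 0 -> k *: a = l *: g ->
    g = a \/ g = - a
}.

(** [coef g a] is the coefficient of the simple root [a] in the simple root
    expansion of the root [g]; it is determined by [simple_free] and
    [coef_expansion], and its values elsewhere are irrelevant. *)
Record root_base n (Phi : root_datum n) := RootBase {
  simple : {fset 'rV[int]_n};
  coef : 'rV[int]_n -> 'rV[int]_n -> int;
  simple_roots : simple `<=` roots Phi;
  simple_free : forall c : 'rV[int]_n -> int,
    \sum_(a <- simple) c a *: a = 0 -> forall a, a \in simple -> c a = 0;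
  coef_expansion : forall g, g \in roots Phi ->
    g = \sum_(a <- simple) coef g a *: a;
  coef_sign : forall g, g \in roots Phi ->
    (forall a, a \in simple -> 0 <= coef g a) \/
    (forall a, a \in simple -> coef g a <= 0)
}.

Section Roots.

Variables (n : nat) (Phi : root_datum n) (D : root_base Phi).

Definition pos_roots : {fset 'rV[int]_n} :=
  [fset g in roots Phi | all (fun a => 0 <= coef D g a) (simple D)].

Definition root_covers (a g : pos_roots) : bool := val g - val a \in simple D.

Definition root_lt (a g : pos_roots) : bool :=
  [exists d, root_covers a d && connect root_covers d g].

Definition cominuscule (beta : simple D) : Prop :=
  forall g, g \in pos_roots ->
    coef D g (val beta) != 0 -> coef D g (val beta) = 1.

Lemma coef_simple a b : a \in simple D -> b \in simple D ->
  coef D a b = (b == a)%:R.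
Proof.
move=> aD bD; have aR := fsubsetP (simple_roots D) _ aD.
apply/eqP; rewrite -subr_eq0; apply/eqP.
apply: (@simple_free _ _ D (fun x => coef D a x - (x == a)%:R)) bD.
under eq_bigr do rewrite scalerBl.
rewrite sumrB -coef_expansion // (big_fsetD1 a) //= eqxx scale1r.
rewrite big1_fset ?addr0 ?subrr // => x; rewrite !inE => /andP[/negPf-> _] _.
by rewrite scale0r.
Qed.

Lemma simple_pos a : a \in simple D -> a \in pos_roots.
Proof.
move=> aD; rewrite !inE /= (fsubsetP (simple_roots D)) //=.
by apply/allP => b bD; rewrite coef_simple.
Qed.

End Roots.

Section Tableaux.

Variables (n : nat) (Phi : root_datum n) (D : root_base Phi).
Variable beta : simple D.

(** The poset Lambda_{G/P}. *)
Definition box : finType :=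
  {g : pos_roots D | coef D (val g) (val beta) != 0}.

Definition box_lt (x y : box) : bool := root_lt (val x) (val y).

(** Lambda_{G/P} is an upper set of the positive roots, so covering relations
    of the subposet are those of the positive roots. *)
Definition box_covers (x y : box) : bool := root_covers (val x) (val y).

Lemma coef_beta_neq0 :
  coef D (val [` simple_pos (valP beta)]) (val beta) != 0.
Proof. by rewrite /= coef_simple ?eqxx ?(valP beta). Qed.

Definition beta_box : box := exist _ [` simple_pos (valP beta)] coef_beta_neq0.

Definition straight_shape (la : {set box}) : Prop :=
  forall x y, y \in la -> box_lt x y -> x \in la.

(** A filling carries the label [T x] in box [x]; label [0] encodes that [x] is
    not in the shape of [T]. *)
Definition filling : Type := {ffun box -> nat}.

Definition shape (T : filling) : {set box} := [set x | T x != 0%N].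

Record SYT_skew (nu la : {set box}) (T : filling) : Prop := {
  SYT_shape : shape T = nu :\: la;
  SYT_range : forall x, x \in nu :\: la -> (1 <= T x <= #|nu :\: la|)%N;
  SYT_inj : {in nu :\: la &, injective T};
  SYT_surj : forall k : nat, (1 <= k <= #|nu :\: la|)%N ->
    exists2 x, x \in nu :\: la & T x = k;
  SYT_increasing : {in nu :\: la &, forall x y, box_lt x y -> (T x < T y)%N}
}.

Definition SYT (la : {set box}) (T : filling) : Prop := SYT_skew la set0 T.

Definition slide_target (T : filling) (x y : box) : bool :=
  [&& box_covers x y, y \in shape T &
      [forall z, (box_covers x z && (z \in shape T)) ==> (T y <= T z)%N]].

Definition move_label (T : filling) (x y : box) : filling :=
  [ffun z => if z == x then T y else if z == y then 0%N else T z].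

Fixpoint slide (fuel : nat) (x : box) (T : filling) : filling :=
  if fuel is m.+1 then
    if [pick y | slide_target T x y] is Some y
    then slide m y (move_label T x y) else T
  else T.

(** The vacant box moves up at every step, so [#|box|] steps are enough. *)
Definition jdt (x : box) (T : filling) : filling := slide #|box| x T.

(** Decrementing all labels also erases the entry [1]. *)
Definition erase1 (T : filling) : filling := [ffun x => (T x).-1].

(** If [T] has one box then [erase1 T] is empty and the slide does nothing. *)
Definition jdt_erase (T : filling) : filling := jdt beta_box (erase1 T).

(** [k : 'I_#|shape T|] stands for the label [k.+1]. *)
Definition evac (T : filling) : filling :=
  [ffun x =>
    if [pick k : 'I_#|shape T| |
          x \in shape (iter (#|shape T| - k.+1) jdt_erase T)
            :\: shape (iter (#|shape T| - k) jdt_erase T)] is Some k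
    then k.+1 else 0%N].

End Tableaux.

(* Main.v *)
From HB Require Import structures.
From mathcomp Require Import all_boot all_order all_algebra.
From mathcomp Require Import finmap.
From mathcomp Require Import zify ring.
Require Import Defs.

Set Implicit Arguments.
Unset Strict Implicit.
Unset Printing Implicit Defensive.

Import Order.TTheory GRing.Theory Num.Theory.

(** The theorem has a root-theoretic half and a combinatorial half.

    Roots: the only property of [Lambda_{G/P}] that matters is that it is a
    finite poset with least element [beta] ([beta_box_min]).  To prove it, let
    [g <= h] coefficientwise be two distinct roots of [Lambda_{G/P}].  Their
    difference is a nonnegative combination of simple roots, and it has positive
    norm for the invariant form [form]; hence some simple root [a] of its
    support satisfies [(h, a) > 0] or [(g, a) < 0], so that [h - a] or [g + a]
    is a root, again between [g] and [h].  By induction [g] and [h] are joined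
    by a chain of covers ([box_coef_le_connect]).  Because [beta] is
    cominuscule, it is coefficientwise below every root of [Lambda_{G/P}].

    Tableaux: for a poset with a least element, evacuation is a product of
    toggles, where the [i]-th toggle exchanges two consecutive labels unless the
    boxes carrying them are comparable.  Erasing the label 1 and sliding amounts
    to applying the toggles 0, 1, 2, ... in turn to the original tableau and
    then deleting the largest label ([jdt_erase_bubble]): after [k] toggles the
    box labelled [k.+1] is the vacant box of the slide, and it moves up exactly
    when the next toggle is blocked.  So [evac] is the composite
    [E_N = b_0 b_1 ... b_(N-1)], rightmost factor first, where
    [b_k = t_(k-1) ... t_1 t_0] ([evac_evacuate]).  That [E_N] is an involution
    follows formally from [t_i t_i = 1] and [t_i t_j = t_j t_i] for [j > i.+1]:
    moving the leftmost factor of each [b_k] to the left across the shorter ones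
    shows that [E_(k+1) = E_k b_k] is also [b_k^-1 E_k] ([evacuateS]), whence
    [E_(k+1) E_(k+1) = E_k b_k b_k^-1 E_k = E_k E_k] ([evacuateK]). *)

Section RootTheory.
Local Open Scope fset_scope.
Local Open Scope ring_scope.

(** * The invariant form of a root datum *)

Section Pairing.
Variable n : nat.
Implicit Types x y z : 'rV[int]_n.

Lemma pairingDl x y z : pairing (x + y) z = pairing x z + pairing y z.
Proof. by rewrite -big_split; apply: eq_bigr => i _; rewrite mxE mulrDl. Qed.

Lemma pairingZl c x z : pairing (c *: x) z = c * pairing x z.
Proof. by rewrite mulr_sumr; apply: eq_bigr => i _; rewrite mxE mulrA. Qed.

Lemma pairingC x z : pairing x z = pairing z x.
Proof. by apply: eq_bigr => i _; rewrite mulrC. Qed.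

Lemma pairingBl x y z : pairing (x - y) z = pairing x z - pairing y z.
Proof. by rewrite -scaleN1r pairingDl pairingZl mulN1r. Qed.

Lemma pairingBr x y z : pairing x (y - z) = pairing x y - pairing x z.
Proof. by rewrite pairingC pairingBl !(pairingC x). Qed.

Lemma pairingZr c x z : pairing x (c *: z) = c * pairing x z.
Proof. by rewrite pairingC pairingZl pairingC. Qed.
End Pairing.

Section Form.
Variables (n : nat) (Phi : root_datum n).
Implicit Types x y z a g q : 'rV[int]_n.

Definition coroots : {fset 'rV[int]_n} := [fset coroot Phi d | d in roots Phi].

(** The Weyl group invariant form on the character lattice; it is positive on
    roots, but only semidefinite when the roots do not span. *)
Definition form x y : int := \sum_(k <- coroots) pairing x k * pairing y k.

Lemma formC x y : form x y = form y x.
Proof. by apply: eq_bigr => k _; rewrite mulrC. Qed.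

Lemma formBl x y z : form (x - y) z = form x z - form y z.
Proof. by rewrite -sumrB; apply: eq_bigr => k _; rewrite pairingBl mulrBl. Qed.

Lemma formZl c x z : form (c *: x) z = c * form x z.
Proof.
by rewrite mulr_sumr; apply: eq_bigr => k _; rewrite pairingZl mulrA.
Qed.

Lemma formBr x y z : form x (y - z) = form x y - form x z.
Proof. by rewrite formC formBl !(formC x). Qed.

Lemma form_sumr (S : {fset 'rV[int]_n}) (c : 'rV[int]_n -> int) x :
  form x (\sum_(a <- S) c a *: a) = \sum_(a <- S) c a * form x a.
Proof.
apply: (big_rec2 (fun u v => form x u = v)) => [|a u v _ <-].
  by rewrite formC -[0](scale0r 0) formZl mul0r.
rewrite -[u]opprK formBr -[- u]scaleN1r [form x (c a *: a)]formC formZl.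
rewrite [form x (-1 *: u)]formC formZl mulN1r opprK !(formC x).
by rewrite scaleN1r opprK.
Qed.

Lemma form_ge0 x : 0 <= form x x.
Proof. by apply: sumr_ge0 => k _; rewrite -expr2 sqr_ge0. Qed.

Lemma form_eq0 x d : form x x = 0 -> d \in roots Phi ->
  pairing x (coroot Phi d) = 0.
Proof.
move=> /eqP x0 dR.
have kC : coroot Phi d \in coroots by apply: in_imfset.
move: x0; rewrite psumr_eq0 => [|k _]; last by rewrite -expr2 sqr_ge0.
by move=> /allP/(_ _ kC); rewrite /= -expr2 sqrf_eq0 => /eqP.
Qed.

Lemma form_root_gt0 a : a \in roots Phi -> 0 < form a a.
Proof.
move=> aR; rewrite lt_def form_ge0 andbT; apply/eqP => /form_eq0/(_ aR).
by rewrite pairing_coroot.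
Qed.

Definition reflection a g := g - pairing g (coroot Phi a) *: a.

(** The reflection in [a] is an isometry, because the transposed reflection
    permutes the coroots. *)
Lemma form_reflection a x y : a \in roots Phi ->
  form (reflection a x) (reflection a y) = form x y.
Proof.
move=> aR; pose s k := k - pairing a k *: coroot Phi a.
have sE z k : pairing (reflection a z) k = pairing z (s k).
  by rewrite pairingBl pairingZl pairingBr pairingZr; ring.
have sK : involutive s.
  move=> k; rewrite /s pairingBr pairingZr pairing_coroot // scalerBl.
  by rewrite mulr_natr mulr2n scalerDl; apply/rowP => i; rewrite !mxE; ring.
have sC k : k \in coroots -> s k \in coroots.
  by move=> /imfsetP[g gR ->]; apply: reflection_coroots.
have sP : perm_eq coroots (map s coroots).
  apply: uniq_perm => [||k]; first exact: fset_uniq.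
    by rewrite map_inj_uniq ?fset_uniq //; apply: inv_inj.
  apply/idP/mapP => [kC|[l lC ->]]; last exact: sC.
  by exists (s k); rewrite ?sC ?sK.
rewrite /form [RHS](perm_big _ sP) big_map /=.
by apply: eq_bigr => k _; rewrite !sE.
Qed.

(** Invariance under the reflection in [a], which negates [a], gives
    [(x, a) = - (x, a) + <x, a^v> (a, a)]. *)
Lemma form_root x a : a \in roots Phi ->
  2 * form x a = pairing x (coroot Phi a) * form a a.
Proof.
move=> aR; have := form_reflection x a aR.
rewrite /reflection pairing_coroot // !(formBl, formBr) !formZl.
by rewrite ![form _ (2 *: a)]formC !formZl (formC a x); lia.
Qed.

Lemma rootN a : a \in roots Phi -> - a \in roots Phi.
Proof.
move=> aR; have := reflection_roots aR aR; rewrite pairing_coroot //.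
by rewrite -[X in X - _]scale1r -scalerBl scaleN1r.
Qed.

(** If two distinct roots differed by a radical vector [q], then reflecting in
    each other would produce the infinite string of roots [g + k q]. *)
Lemma root_radical_eq a g : a \in roots Phi -> g \in roots Phi ->
  form (g - a) (g - a) = 0 -> g = a.
Proof.
move=> aR gR; set q := g - a => q0.
have qd d : d \in roots Phi -> pairing q (coroot Phi d) = 0 by apply: form_eq0.
have step (k : nat) : a + k%:Z *: q \in roots Phi /\
    a + k.+1%:Z *: q \in roots Phi.
  elim: k => [|k [kR lR]].
    by rewrite scale0r addr0 scale1r addrC subrK.
  split=> //; have := rootN (reflection_roots lR kR).
  have -> : pairing (a + k%:Z *: q) (coroot Phi (a + k.+1%:Z *: q)) = 2.
    rewrite -(pairing_coroot lR) ![pairing (a + _) _]pairingDl !pairingZl.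
    by rewrite !qd ?mulr0.
  rewrite [X in X \in _ -> _](_ : _ = a + k.+2%:Z *: q) //.
  by apply/rowP => i; rewrite !mxE; lia.
apply/eqP; apply: contraT => ga.
pose N := size (roots Phi).
pose s := [seq a + k%:Z *: q | k <- iota 0 N.+1].
have us : uniq s.
  rewrite map_inj_uniq ?iota_uniq // => k l /addrI/eqP.
  rewrite -subr_eq0 -scalerBl scalemx_eq0 [q == 0]subr_eq0 (negPf ga) orbF.
  by rewrite subr_eq0 => /eqP[].
have : (size s <= N)%N.
  by apply: uniq_leq_size => // _ /mapP[k _ ->]; case: (step k).
by rewrite size_map size_iota ltnn.
Qed.

(** If neither [pairing g a^v] nor [pairing a g^v] were 1 then both would be
    at least 2, and [g - a] would have nonpositive norm; when one of them is 1,
    the corresponding reflection is [+- (g - a)]. *)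
Lemma root_sub a g : a \in roots Phi -> g \in roots Phi ->
  0 < form g a -> g = a \/ g - a \in roots Phi.
Proof.
move=> aR gR ga0.
have ea := form_root g aR; have eg := form_root a gR; rewrite formC in eg.
have pa := form_root_gt0 aR; have pg := form_root_gt0 gR.
have [r1|r1] := eqVneq (pairing g (coroot Phi a)) 1.
  by right; have := reflection_roots aR gR; rewrite r1 scale1r.
have [r2|r2] := eqVneq (pairing a (coroot Phi g)) 1.
  by right; have := rootN (reflection_roots gR aR); rewrite r2 scale1r opprB.
left; apply: root_radical_eq => //; apply: le_anti; rewrite form_ge0 andbT.
rewrite formBl !formBr (formC a g).
have : 2 <= pairing g (coroot Phi a) by nia.
have : 2 <= pairing a (coroot Phi g) by nia.
nia.
Qed.

End Form.

(** * The poset of boxes *)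

Section BoxOrder.
Variables (n : nat) (Phi : root_datum n) (D : root_base Phi).
Implicit Types a b g h : 'rV[int]_n.

Lemma coef_unique g (c : 'rV[int]_n -> int) :
    g \in roots Phi -> g = \sum_(a <- simple D) c a *: a ->
  {in simple D, coef D g =1 c}.
Proof.
move=> gR gE a aD; apply/eqP; rewrite -subr_eq0; apply/eqP.
apply: (@simple_free _ _ D (fun a => coef D g a - c a)) aD.
under eq_bigr do rewrite scalerBl.
by rewrite sumrB -coef_expansion // -gE subrr.
Qed.

Lemma coefD_simple g a : g \in roots Phi -> a \in simple D ->
  g + a \in roots Phi ->
  {in simple D, forall b, coef D (g + a) b = coef D g b + (b == a)%:R}.
Proof.
move=> gR aD gaR; apply: coef_unique => //.
under eq_bigr do rewrite scalerDl.
rewrite big_split /= -coef_expansion //; congr (_ + _).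
rewrite {1}(coef_expansion D (fsubsetP (simple_roots D) _ aD)).
by apply: eq_big_seq => b bD; rewrite coef_simple.
Qed.

(** Since [h - g] has positive norm and is a nonnegative combination of simple
    roots, it pairs positively with a simple root [a] of its support; then
    [(h, a) > (g, a)], so these two numbers cannot satisfy
    [(h, a) <= 0 <= (g, a)]. *)
Lemma simple_between g h : g \in roots Phi -> h \in roots Phi -> g != h ->
    {in simple D, forall a, coef D g a <= coef D h a} ->
  exists2 a, a \in simple D & coef D g a < coef D h a /\
    (0 < form Phi h a \/ form Phi g a < 0).
Proof.
move=> gR hR gh le_gh; pose q := h - g.
have qE : q = \sum_(a <- simple D) (coef D h a - coef D g a) *: a.
  under eq_bigr do rewrite scalerBl.
  by rewrite sumrB -!coef_expansion.
have : 0 < form Phi q q.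
  rewrite lt_def form_ge0 andbT; apply: contra_neq gh => /root_radical_eq.
  by move->.
rewrite {2}qE form_sumr => q_gt0.
have /hasP[a aD qa_gt0] :
    has (fun a => 0 < (coef D h a - coef D g a) * form Phi q a) (simple D).
  apply: contraLR q_gt0 => /hasPn q_le0; rewrite -leNgt big_seq.
  by apply: sumr_le0 => a /q_le0; rewrite -leNgt.
exists a => //; have := le_gh a aD; rewrite -subr_ge0 le_eqVlt.
case/predU1P => [c0|c_gt0]; first by rewrite -c0 mul0r in qa_gt0.
split; first by rewrite -subr_gt0.
by move: qa_gt0; rewrite pmulr_rgt0 // formBl; lia.
Qed.

Variable beta : simple D.
Implicit Types x y z : box beta.

Lemma box_coef x a : a \in simple D -> 0 <= coef D (val (val x)) a.
Proof. by have := valP (val x); rewrite !inE => /andP[_ /allP]; apply. Qed.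

Lemma box_root x : val (val x) \in roots Phi.
Proof. by have := valP (val x); rewrite !inE => /andP[]. Qed.

(** Adding a simple root does not decrease the coefficient of [beta]. *)
Lemma covers_box x (z : pos_roots D) : root_covers (val x) z ->
  {y : box beta | val y = z}.
Proof.
move=> cxz; have zx : val z = val (val x) + (val z - val (val x)).
  by rewrite addrC subrK.
have zR : val z \in roots Phi by have := valP z; rewrite !inE => /andP[].
have /= bD := valP beta.
suff z0 : coef D (val z) (val beta) != 0 by exists (exist _ z z0).
rewrite zx coefD_simple -?zx ?box_root //.
by rewrite gt_eqF // ltr_wpDr ?ler0n // lt_def (valP x) box_coef.
Qed.

Lemma box_lt_covers x y : box_lt x y ->
  exists2 z, box_covers x z & z = y \/ box_lt z y.
Proof.
case/existsP => d /andP[cxd /connectP[p]].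
have [z zd] := covers_box cxd; rewrite -zd in cxd *.
case: p => [_ /val_inj yz|d' p /= /andP[czd' pP] yE]; exists z => //.
  by left.
right; apply/existsP; exists d'; rewrite czd'.
by apply/connectP; exists p.
Qed.

Lemma box_covers_lt x y : box_covers x y -> box_lt x y.
Proof.
by move=> cxy; apply/existsP; exists (val y); rewrite connect0 andbT.
Qed.

Hypothesis hbeta : cominuscule beta.

Lemma box_coef_beta x : coef D (val (val x)) (val beta) = 1.
Proof. by apply: hbeta (valP (val x)) (valP x). Qed.

Lemma mk_box g : g \in roots Phi -> {in simple D, forall a, 0 <= coef D g a} ->
  coef D g (val beta) = 1 -> exists x, val (val x) = g.
Proof.
move=> gR g0 gb.
have gP : g \in pos_roots D by rewrite !inE gR; apply/allP.
have gb0 : coef D (val [` gP]) (val beta) != 0 by rewrite /= gb.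
by exists (exist _ [` gP] gb0).
Qed.

(** Coefficientwise comparison implies comparison in [Lambda_{G/P}]: a simple
    root given by [simple_between] can be subtracted from [y] or added to [x]
    while staying between the two, and it is not [beta] since both [x] and [y]
    have [beta]-coefficient 1. *)
Lemma box_coef_le_connect x y :
    {in simple D, forall a,
      coef D (val (val x)) a <= coef D (val (val y)) a} ->
  connect (@root_covers _ _ D) (val x) (val y).
Proof.
pose ht z := \sum_(a <- simple D) coef D (val (val z)) a.
(* Each step brings the heights of [x] and [y] closer by one. *)
have [m] : exists m : nat, ht y - ht x < m%:Z.
  by exists (`|ht y - ht x|.+1)%N; lia.
elim: m x y => [|m IHm] x y ltm le_xy.
  by move: ltm; rewrite ltNge subr_ge0 /ht !big_seq ler_sum.
have [/val_inj/val_inj->|xy] := eqVneq (val (val x)) (val (val y)).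
  exact: connect0.
have /= bD := valP beta.
have [a aD [lt_a form_a]] := simple_between (box_root x) (box_root y) xy le_xy.
have ab : a != val beta.
  by apply: contraTneq lt_a => ->; rewrite !box_coef_beta.
have aR := fsubsetP (simple_roots D) _ aD.
have htD u v : val (val v) = val (val u) + a -> ht v = ht u + 1.
  move=> vu; have vR : val (val u) + a \in roots Phi.
    by rewrite -vu box_root.
  rewrite /ht vu (eq_big_seq _ (coefD_simple (box_root u) aD vR)) big_split /=.
  congr (_ + _); rewrite (big_fsetD1 a) //= eqxx big1_fset ?addr0 // => b.
  by rewrite !inE => /andP[/negPf-> _].
have [ya|xa] : (val (val y) - a \in roots Phi) \/
               (val (val x) + a \in roots Phi).
- case: form_a => [ya|xa].
    have [yE|] := root_sub aR (box_root y) ya; last by left.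
    have := box_coef_beta y; rewrite yE coef_simple //.
    by rewrite eq_sym (negPf ab).
  right; rewrite -[a]opprK; have xNa : 0 < form Phi (val (val x)) (- a).
    by rewrite formC -scaleN1r formZl formC mulN1r oppr_gt0.
  have [xE|//] := root_sub (rootN aR) (box_root x) xNa.
  have := box_coef x aD; rewrite xE.
  have NaE : - a = \sum_(b <- simple D) (- coef D a b) *: b.
    under eq_bigr do rewrite scaleNr.
    by rewrite sumrN -coef_expansion.
  by rewrite (coef_unique (rootN aR) NaE) // coef_simple // eqxx.
- have yaK : val (val y) = val (val y) - a + a by rewrite subrK.
  have cE : {in simple D, forall b, coef D (val (val y)) b =
      coef D (val (val y) - a) b + (b == a)%:R}.
    by move=> b bS; rewrite {1}yaK coefD_simple -?yaK ?box_root.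
  have le_xya : {in simple D, forall b,
      coef D (val (val x)) b <= coef D (val (val y) - a) b}.
    move=> b bS; have [->|ba] := eqVneq b a.
      by move: lt_a; rewrite cE // eqxx ltzD1.
    by move: (le_xy b bS); rewrite cE // (negPf ba) addr0.
  have [||z zE] := mk_box ya.
  + by move=> b bS; apply: le_trans (box_coef x bS) (le_xya b bS).
  + by have := cE _ bD; rewrite box_coef_beta eq_sym (negPf ab) addr0.
  rewrite -zE in yaK le_xya.
  apply: connect_trans (IHm x z _ le_xya) (connect1 _).
    by move: ltm; rewrite (htD z y yaK); clear; lia.
  by rewrite /root_covers yaK addrC addKr.
- have cE := coefD_simple (box_root x) aD xa.
  have [||z zE] := mk_box xa.
  + by move=> b bS; rewrite cE // addr_ge0 ?ler0n ?box_coef.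
  + by rewrite cE // box_coef_beta eq_sym (negPf ab) addr0.
  apply: connect_trans (connect1 _) (IHm z y _ _).
  + by rewrite /root_covers zE addrC addKr.
  + by move: ltm; rewrite (htD x z zE); clear; lia.
  + move=> b bS; rewrite zE cE //; have [->|_] := eqVneq b a.
      by rewrite lezD1.
    by rewrite addr0 le_xy.
Qed.

Lemma beta_box_min x : x = beta_box beta \/ box_lt (beta_box beta) x.
Proof.
have /connectP[p] : connect (@root_covers _ _ D) (val (beta_box beta)) (val x).
  apply: box_coef_le_connect => a aD /=; rewrite coef_simple ?(valP beta) //.
  by case: eqP => [->|_] /=; rewrite ?box_coef_beta ?box_coef.
case: p => [_ /val_inj|d p /= /andP[cd pP] xE]; first by left.
by right; apply/existsP; exists d; rewrite cd; apply/connectP; exists p.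
Qed.

End BoxOrder.
End RootTheory.

(** * Evacuation as a word in commuting involutions *)

Section AbstractEvacuation.
Variables (X : Type) (t : nat -> X -> X).

Fixpoint bubble k x := if k is m.+1 then t m (bubble m x) else x.

Fixpoint bubble_inv k x := if k is m.+1 then bubble_inv m (t m x) else x.

Fixpoint evacuate k x := if k is m.+1 then evacuate m (bubble m x) else x.

Lemma bubble_comm (f : X -> X) k :
    (forall i x, i < k -> f (t i x) = t i (f x)) ->
  forall x, f (bubble k x) = bubble k (f x).
Proof.
elim: k => //= k IHk ft x; rewrite ft // IHk // => i y ik.
by apply: ft; apply: ltnW.
Qed.

Lemma evacuate_comm (f : X -> X) k :
    (forall i x, i.+1 < k -> f (t i x) = t i (f x)) ->
  forall x, f (evacuate k x) = evacuate k (f x).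
Proof.
elim: k => //= k IHk ft x; rewrite IHk => [|i y ik]; last by rewrite ft // ltnW.
by rewrite bubble_comm // => i y ik; apply: ft.
Qed.

Lemma bubble_ind (P : X -> Prop) k :
    (forall i x, i < k -> P x -> P (t i x)) ->
  forall x, P x -> P (bubble k x).
Proof.
elim: k => //= k IHk Pt x Px; apply: (Pt) => //; apply: IHk => // i y ik.
by apply: Pt; apply: ltnW.
Qed.

Lemma evacuate_ind (P : X -> Prop) k :
    (forall i x, i.+1 < k -> P x -> P (t i x)) ->
  forall x, P x -> P (evacuate k x).
Proof.
elim: k => //= k IHk Pt x Px; apply: IHk => [i y ik|]; first by apply/Pt/ltnW.
exact: bubble_ind Px.
Qed.

Hypothesis tK : forall i, involutive (t i).
Hypothesis tC : forall i j x, i.+1 < j -> t i (t j x) = t j (t i x).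

Lemma bubble_invK k : cancel (bubble_inv k) (bubble k).
Proof. by elim: k => //= k IHk x; rewrite IHk tK. Qed.

(** In [evacuate k.+2 = evacuate k.+1 o t_k o bubble k] the induction hypothesis
    turns [evacuate k.+1] into [bubble_inv k o evacuate k], and [evacuate k]
    only involves the [t_i] with [i.+1 < k], which commute with [t_k]. *)
Lemma evacuateS k x : evacuate k.+1 x = bubble_inv k (evacuate k x).
Proof.
elim: k x => // k IHk x; rewrite -[LHS]/(evacuate k.+1 (t k (bubble k x))) IHk.
by rewrite -(@evacuate_comm (t k)) // => i y ik; exact/esym/tC.
Qed.

Lemma evacuateK k : involutive (evacuate k).
Proof.
elim: k => // k IHk x.
by rewrite [evacuate k.+1 x]evacuateS /= bubble_invK IHk.
Qed.

End AbstractEvacuation.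

(** * Toggles on fillings *)

Section Toggles.
Variables (n : nat) (Phi : root_datum n) (D : root_base Phi) (beta : simple D).
Implicit Types (T U : filling beta) (x y z : box beta) (la : {set box beta}).
Implicit Types i j k m : nat.

Definition swap_label i k :=
  if k == i.+1 then i.+2 else if k == i.+2 then i.+1 else k.

Lemma swap_labelK i : involutive (swap_label i).
Proof. by move=> k; rewrite /swap_label; do !case: eqP => //; lia. Qed.

Definition blocked i T : bool :=
  [exists x, exists y,
    [&& T x == i.+1, T y == i.+2 & box_lt x y || box_lt y x]].

Lemma blockedP i T : reflect
  (exists x y, [/\ T x = i.+1, T y = i.+2 & box_lt x y || box_lt y x])
  (blocked i T).
Proof.
apply: (iffP existsP) => [[x /existsP[y /and3P[/eqP Tx /eqP Ty xy]]]|].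
  by exists x, y.
move=> [x [y [Tx Ty xy]]]; exists x; apply/existsP; exists y.
by rewrite Tx Ty !eqxx.
Qed.

(** The label 0 means absence of a label, hence the [i]-th toggle concerns the
    labels [i.+1] and [i.+2]. *)
Definition toggle i T : filling beta :=
  if blocked i T then T else [ffun z => swap_label i (T z)].

Lemma toggleK i : involutive (toggle i).
Proof.
move=> T; rewrite {2}/toggle; case: ifPn => Tb; rewrite /toggle.
  by rewrite Tb.
rewrite ifN; first by apply/ffunP => z; rewrite !ffunE swap_labelK.
apply: contraNN Tb => /blockedP[x [y [Tx Ty xy]]].
apply/blockedP; exists y, x; rewrite orbC; split => //.
  rewrite -[T y](swap_labelK i); move: Ty; rewrite ffunE => ->.
  by rewrite /swap_label eqxx gtn_eqF.
rewrite -[T x](swap_labelK i); move: Tx; rewrite ffunE => ->.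
by rewrite /swap_label eqxx.
Qed.

Lemma blocked_eq i T U :
    (forall z, (T z == i.+1) = (U z == i.+1)) ->
    (forall z, (T z == i.+2) = (U z == i.+2)) ->
  blocked i T = blocked i U.
Proof.
by move=> e1 e2; apply: eq_existsb => x; apply: eq_existsb => y; rewrite e1 e2.
Qed.

(** The two pairs of labels are disjoint, so neither toggle affects whether the
    other is blocked. *)
Lemma toggle_comm i j T : i.+1 < j ->
  toggle i (toggle j T) = toggle j (toggle i T).
Proof.
move=> ij; have bi : blocked i (toggle j T) = blocked i T.
  rewrite /toggle; case: ifP => // _.
  apply: blocked_eq => z; rewrite ffunE /swap_label;
  by do !case: (T z =P _) => //; lia.
have bj : blocked j (toggle i T) = blocked j T.
  rewrite /toggle; case: ifP => // _.
  apply: blocked_eq => z; rewrite ffunE /swap_label;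
  by do !case: (T z =P _) => //; lia.
rewrite {1}/toggle bi [RHS]/toggle bj /toggle.
case: ifP; case: ifP => // _ _; apply/ffunP => z; rewrite !ffunE /swap_label.
by do !case: eqP; lia.
Qed.

Definition restrict k T : filling beta :=
  [ffun z => if T z <= k then T z else 0].

Lemma toggle_restrict k i T : i.+1 < k ->
  toggle i (restrict k T) = restrict k (toggle i T).
Proof.
move=> ik; rewrite /toggle (@blocked_eq i (restrict k T) T); first last.
- by move=> z; rewrite ffunE; case: leqP; lia.
- by move=> z; rewrite ffunE; case: leqP; lia.
case: ifP => // _; apply/ffunP => z; rewrite !ffunE /swap_label.
by case: (leqP (T z) k) => Tz; do !case: eqP; try case: leqP; lia.
Qed.

Lemma toggle_lower_set k i T z : i.+1 < k ->
  (0 < toggle i T z <= k) = (0 < T z <= k).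
Proof.
move=> ik; rewrite /toggle; case: ifP => // _; rewrite ffunE /swap_label.
by do !case: eqP; lia.
Qed.

Section Standard.
Variables (la : {set box beta}) (T : filling beta).
Hypothesis hT : SYT la T.

Lemma SYT_supp x : (x \in la) = (0 < T x).
Proof.
by have [/setP/(_ x)] := hT; rewrite setD0 inE lt0n => ->.
Qed.

Lemma SYT_le x : T x <= #|la|.
Proof.
have [|xla] := boolP (x \in la); last by move: xla; rewrite SYT_supp; lia.
by have [_ rT _ _ _] := hT; rewrite setD0 in rT; case/rT/andP.
Qed.

Lemma SYT_label_inj x y : 0 < T x -> T x = T y -> x = y.
Proof.
have [_ _ iT _ _] := hT; rewrite setD0 in iT => Tx Txy.
by apply: iT => //; rewrite SYT_supp -?Txy.
Qed.

Lemma SYT_label k : 0 < k <= #|la| -> exists x, T x = k.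
Proof.
by have [_ _ _ sT _] := hT; rewrite setD0 in sT => /sT[x _ Tx]; exists x.
Qed.

Lemma SYT_lt x y : 0 < T x -> 0 < T y -> box_lt x y -> T x < T y.
Proof.
have [_ _ _ _ lT] := hT; rewrite setD0 in lT => Tx Ty; apply: lT => //;
by rewrite SYT_supp.
Qed.
End Standard.

Lemma SYT_intro la T :
    (forall x, (x \in la) = (0 < T x)) -> (forall x, T x <= #|la|) ->
    (forall x y, 0 < T x -> T x = T y -> x = y) ->
    (forall k, 0 < k <= #|la| -> exists x, T x = k) ->
    (forall x y, 0 < T x -> 0 < T y -> box_lt x y -> T x < T y) ->
  SYT la T.
Proof.
move=> sT rT iT oT lT; split; rewrite setD0.
- by apply/setP => x; rewrite inE sT lt0n.
- by move=> x; rewrite sT rT andbT.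
- by move=> x y; rewrite !sT => Tx _; apply: iT.
- move=> k kla; have [x Tx] := oT k kla; exists x; rewrite // sT Tx.
  by case/andP: kla.
- by move=> x y; rewrite !sT; apply: lT.
Qed.

(** An exchange can only violate monotonicity for the pair of boxes carrying the
    two labels, and then the toggle is blocked. *)
Lemma SYT_toggle la i T : i.+1 < #|la| -> SYT la T -> SYT la (toggle i T).
Proof.
move=> ila hT; rewrite /toggle; case: ifPn => // /blockedP nb.
apply: SYT_intro => [x|x|x y|k kla|x y].
- by rewrite ffunE (SYT_supp hT) /swap_label; do !case: eqP; lia.
- rewrite ffunE; have := SYT_le hT x; rewrite /swap_label.
  by do !case: eqP; lia.
- rewrite !ffunE => Tx /(can_inj (swap_labelK i)); apply: (SYT_label_inj hT).
  by move: Tx; rewrite /swap_label; do !case: eqP; lia.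
- have [|x Tx] := SYT_label hT (k := swap_label i k).
    by move: kla; rewrite /swap_label; do !case: eqP; lia.
  by exists x; rewrite ffunE Tx swap_labelK.
- rewrite !ffunE => Tx Ty xy.
  have {Tx}Tx : 0 < T x by move: Tx; rewrite /swap_label; do !case: eqP; lia.
  have {Ty}Ty : 0 < T y by move: Ty; rewrite /swap_label; do !case: eqP; lia.
  have Txy := SYT_lt hT Tx Ty xy.
  have : ~ (T x = i.+1 /\ T y = i.+2).
    by case=> Tx1 Ty2; apply: nb; exists x, y; rewrite xy.
  by rewrite /swap_label; do !case: eqP; lia.
Qed.

Lemma straight_restrict la T k : straight_shape la -> SYT la T ->
  straight_shape [set x in la | T x <= k].
Proof.
move=> hla hT x y; rewrite !inE => /andP[yla Ty] xy.
have xla := hla _ _ yla xy; rewrite xla.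
by apply: leq_trans Ty; apply/ltnW/(SYT_lt hT); rewrite -?(SYT_supp hT).
Qed.

Lemma card_restrict la T k : SYT la T -> k <= #|la| ->
  #|[set x in la | T x <= k]| = k.
Proof.
move=> hT kla; set A := [set _ in _ | _].
have mA x : (x \in enum A) = (0 < T x <= k).
  by rewrite mem_enum inE (SYT_supp hT).
(* The labels of [A] are a permutation of 1, ..., k. *)
rewrite cardE -(size_map T) (@perm_size _ _ (iota 1 k)) ?size_iota //.
apply: uniq_perm => [||l]; rewrite ?iota_uniq //.
  rewrite map_inj_in_uniq ?enum_uniq // => x y; rewrite mA => /andP[Tx _] _.
  exact: (SYT_label_inj hT).
rewrite mem_iota; apply/mapP/idP => [[x]|lk]; first by rewrite mA => Tx ->; lia.
have [|x Tx] := SYT_label hT (k := l); first by lia.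
by exists x; rewrite ?mA Tx //; lia.
Qed.

Lemma SYT_restrict la T k : SYT la T -> k <= #|la| ->
  SYT [set x in la | T x <= k] (restrict k T).
Proof.
move=> hT kla; apply: SYT_intro; rewrite ?card_restrict //.
- move=> x; rewrite !inE ffunE (SYT_supp hT).
  by case: (leqP (T x) k); rewrite ?andbF ?andbT.
- by move=> x; rewrite ffunE; case: (leqP (T x) k).
- move=> x y; rewrite !ffunE; case: (leqP (T x) k) => // _ Tx.
  case: (leqP (T y) k) => [_|_ Tx0]; first exact: (SYT_label_inj hT).
  by rewrite Tx0 in Tx.
- move=> l lk; have [|x Tx] := SYT_label hT (k := l); first by lia.
  by exists x; rewrite ffunE Tx ifT //; lia.
- move=> x y; rewrite !ffunE; case: (leqP (T x) k) => // _ Tx.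
  case: (leqP (T y) k) => // _ Ty; exact: (SYT_lt hT).
Qed.

End Toggles.

(** * Jeu de taquin by toggles *)

Section Evacuation.
Variables (n : nat) (Phi : root_datum n) (D : root_base Phi) (beta : simple D).
Implicit Types (T U : filling beta) (x y z : box beta) (la : {set box beta}).
Implicit Types i j k m : nat.
Notation toggle_on := (@toggle _ _ _ beta).

(** The filling seen by a slide when the box labelled [k.+1] in [T] is vacant,
    the labels up to [k] have found their place and the larger ones still await
    their decrement. *)
Definition lower k T : filling beta :=
  [ffun z => if T z <= k then T z else if T z == k.+1 then 0 else (T z).-1].

Lemma erase1_lower T : erase1 T = lower 0 T.
Proof. by apply/ffunP => z; rewrite !ffunE; case: (T z) => // -[]. Qed.

Lemma lower_top la k T : SYT la T -> #|la| <= k.+1 ->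
  lower k T = restrict k T.
Proof.
move=> hT lak; apply/ffunP => z; rewrite !ffunE.
case: leqP => // kz; have := SYT_le hT z; case: eqP => //; lia.
Qed.

Section Slide.
Variable la : {set box beta}.
Hypothesis hla : straight_shape la.

(** A box above [x] has a label larger than [k.+1], so the box [y] labelled
    [k.+2] carries the smallest label there.  It covers [x]: a cover of
    [x] below [y] would have a label strictly between [k.+1] and [k.+2]. *)
Lemma slide_target_succ T k x y : SYT la T -> T x = k.+1 -> T y = k.+2 ->
  box_lt x y -> slide_target (lower k T) x =1 pred1 y.
Proof.
move=> hT Tx Ty xy.
have yla : y \in la by rewrite (SYT_supp hT) Ty.
have Sy : lower k T y = k.+1 by rewrite ffunE Ty !ifN //; lia.
have up z : box_covers x z -> z \in shape (lower k T) -> k.+2 <= T z.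
  move=> /box_covers_lt xz; rewrite inE ffunE => Sz.
  have Tz : 0 < T z by case: (T z) Sz => //=; case: ifP.
  by rewrite -Tx; apply: (SYT_lt hT) => //; rewrite Tx.
have cxy : box_covers x y.
  have [z cxz [<- //|zy]] := box_lt_covers xy.
  have zla : z \in la by apply: hla zy.
  have Tz : 0 < T z by rewrite -(SYT_supp hT).
  have := SYT_lt hT (y := y) Tz; rewrite Ty => /(_ isT zy).
  have := SYT_lt hT (x := x) (y := z); rewrite Tx Tz => /(_ isT isT).
  by move/(_ (box_covers_lt cxz)); lia.
have ysh : y \in shape (lower k T) by rewrite inE Sy.
move=> z /=; apply/idP/eqP => [/and3P[cxz zsh /forallP/(_ y)]|->].
  rewrite cxy ysh Sy /= => zy; have Tz := up z cxz zsh.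
  apply: (SYT_label_inj hT); first by lia.
  by move: zy; rewrite Ty ffunE; case: ifP => [|_]; [lia|case: eqP; lia].
rewrite /slide_target cxy ysh.
apply/forallP => w; apply/implyP => /andP[cxw wsh].
have := up w cxw wsh; rewrite Sy ffunE; case: ifP => [|_]; [lia|case: eqP; lia].
Qed.

Lemma slide_target_top T k x : SYT la T -> T x = k.+1 -> #|la| = k.+1 ->
  slide_target (lower k T) x =1 pred0.
Proof.
move=> hT Tx lak z; apply/negP => /and3P[/box_covers_lt xz zsh _].
have Tz : 0 < T z.
  by move: zsh; rewrite inE ffunE; case: (T z) => //=; case: ifP.
have := SYT_lt hT _ Tz xz; rewrite Tx => /(_ isT).
by have := SYT_le hT z; lia.
Qed.

Lemma blocked_lt T k x y : SYT la T -> T x = k.+1 -> T y = k.+2 ->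
  blocked k T = box_lt x y.
Proof.
move=> hT Tx Ty; apply/blockedP/idP => [[x' [y' [Tx' Ty' xy]]]|xy]; last first.
  by exists x, y; rewrite xy.
have -> : x = x' by apply: (SYT_label_inj hT); rewrite Tx.
have -> : y = y' by apply: (SYT_label_inj hT); rewrite Ty.
case/orP: xy => // yx'; have := SYT_lt hT _ _ yx'.
by rewrite Tx' Ty' => /(_ isT isT); lia.
Qed.

Lemma lower_succ_eq k l : l != k.+1 -> l != k.+2 ->
  (if l <= k.+1 then l else if l == k.+2 then 0 else l.-1) =
  (if l <= k then l else if l == k.+1 then 0 else l.-1).
Proof.
move=> l1 l2; have [lk|lk] := leqP l k; first by rewrite leqW.
by rewrite !ifN //; lia.
Qed.

(** Blocked toggle: the slide moves one step. *)
Lemma lower_blocked T k x y : SYT la T -> T x = k.+1 -> T y = k.+2 ->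
  move_label (lower k T) x y = lower k.+1 T.
Proof.
move=> hT Tx Ty; apply/ffunP => z; rewrite !ffunE.
have [->|zx] := eqVneq z x; first by rewrite Tx Ty leqnn !ifN //; lia.
have [->|zy] := eqVneq z y; first by rewrite Ty ltnn eqxx.
apply: esym; apply: lower_succ_eq.
  by apply: contra_neq zx => Tz; apply: (SYT_label_inj hT); rewrite Tz.
by apply: contra_neq zy => Tz; apply: (SYT_label_inj hT); rewrite Tz.
Qed.

(** Effective toggle: the slide does nothing, and the vacant box merely acquires
    the next label. *)
Lemma lower_swap T k : ~~ blocked k T ->
  lower k.+1 (toggle k T) = lower k T.
Proof.
move=> /negPf nb; apply/ffunP => z; rewrite /toggle nb !ffunE.
move: (T z) => l; rewrite /swap_label.
have [->|l1] := eqVneq l k.+1; first by rewrite !ltnn !eqxx.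
have [->|l2] := eqVneq l k.+2; last first.
  by have := lower_succ_eq l1 l2; rewrite (negPf l1) (negPf l2).
by rewrite leqnn !ifN //; lia.
Qed.

(** Each toggle advances the slide by at most one step, so [m] remaining toggles
    need fuel at most [m]. *)
Lemma slide_bubble T : SYT la T -> forall m k fuel x,
    k + m.+1 = #|la| -> m <= fuel -> bubble toggle_on k T x = k.+1 ->
  slide fuel x (lower k (bubble toggle_on k T)) =
    restrict (k + m) (bubble toggle_on (k + m) T).
Proof.
move=> hT; elim=> [|m IHm] k fuel x kla mf Ux.
  have hU : SYT la (bubble toggle_on k T).
    by apply: bubble_ind hT => i U ik; apply: SYT_toggle; lia.
  rewrite addn0 -(lower_top hU) -?kla ?addn1 //.
  case: fuel {mf} => //= f; case: pickP => // y.
  by rewrite (slide_target_top hU) // -kla addn1.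
have hU : SYT la (bubble toggle_on k T).
  by apply: bubble_ind hT => i U ik; apply: SYT_toggle; lia.
have [|y Uy] := SYT_label hU (k := k.+2); first by lia.
have US : bubble toggle_on k.+1 T = toggle k (bubble toggle_on k T) by [].
have [xy|xy] := boolP (box_lt x y).
  have UE : bubble toggle_on k.+1 T = bubble toggle_on k T.
    by rewrite US /toggle (blocked_lt hU Ux Uy) xy.
  case: fuel mf => // f mf /=; case: pickP => [y'|/(_ y)]; last first.
    by rewrite (slide_target_succ hU Ux Uy xy) /= eqxx.
  rewrite (slide_target_succ hU Ux Uy xy) => /eqP->.
  rewrite (lower_blocked hU Ux Uy) -UE IHm ?addSnnS //.
  by rewrite UE.
have nb : ~~ blocked k (bubble toggle_on k T) by rewrite (blocked_lt hU Ux Uy).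
rewrite -(lower_swap nb) -US IHm ?addSnnS //; first exact: ltnW.
by rewrite US /toggle (negPf nb) ffunE Ux /swap_label eqxx.
Qed.

(** The least element carries the label 1, so the slide starts in the box from
    which the toggles start. *)
Lemma jdt_erase_bubble T m : cominuscule beta -> SYT la T -> #|la| = m.+1 ->
  jdt_erase T = restrict m (bubble toggle_on m T).
Proof.
move=> hbeta hT lam; rewrite /jdt_erase /jdt erase1_lower.
rewrite (slide_bubble hT (k := 0) (m := m)) ?lam //.
  by apply: leq_trans (max_card (mem la)); rewrite lam.
have [|x Tx] := SYT_label hT (k := 1); first by rewrite lam.
have [<- //|bx] := beta_box_min hbeta x.
have xla : x \in la by rewrite (SYT_supp hT) Tx.
have := hla xla bx; rewrite (SYT_supp hT) => Tb.
by have := SYT_lt hT Tb _ bx; rewrite Tx => /(_ isT); lia.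
Qed.

End Slide.

(** The deleted labels are kept in [U]: toggling [U] below [k] commutes with
    restricting to the labels up to [k], so the iterated slides and the partial
    products of [evacuate] run in parallel. *)
Lemma iter_jdt_erase la T : cominuscule beta -> straight_shape la ->
    SYT la T -> forall k, k <= #|la| ->
  exists2 U, SYT la U &
    iter (#|la| - k) (@jdt_erase _ _ _ beta) T = restrict k U /\
    evacuate toggle_on #|la| T = evacuate toggle_on k U.
Proof.
move=> hbeta hla hT k kla; rewrite -(subKn kla).
(* Induction on the number [#|la| - k] of slides performed so far. *)
have : #|la| - k <= #|la| by apply: leq_subr.
elim: (#|la| - k) => {k kla} [|j IHj] jla.
  exists T => //; rewrite subn0 subnn; split=> //; apply/ffunP => z.
  by rewrite ffunE (SYT_le hT).
have [U hU [itE evE]] := IHj (ltnW jla).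
have [k jk] : exists k, #|la| - j = k.+1 by exists (#|la| - j.+1); lia.
have -> : #|la| - j.+1 = k by lia.
have kla : k < #|la| by lia.
exists (bubble toggle_on k U).
  by apply: bubble_ind hU => i V ik; apply: SYT_toggle; lia.
have -> : #|la| - k = j.+1 by lia.
have jE : #|la| - (#|la| - j) = j by lia.
rewrite jE jk in itE; rewrite jk in evE; split=> //.
have hR := SYT_restrict hU kla.
have cR := card_restrict hU kla.
rewrite iterS itE (jdt_erase_bubble (straight_restrict hla hU) hbeta hR cR).
rewrite -(@bubble_comm _ _ (restrict k.+1)) => [|i V ik].
  apply/ffunP => z; rewrite !ffunE.
  have [zk|zk] := leqP (bubble toggle_on k U z) k; first by rewrite leqW // zk.
  by case: (bubble toggle_on k U z <= k.+1); rewrite ?[_ <= k]leqNgt ?zk.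
by rewrite toggle_restrict.
Qed.

(** The toggles still to be applied to [U] only permute the labels up to [k], so
    the [k]-th shape of the chain is already the set of boxes whose final label
    is at most [k]. *)
Lemma evac_evacuate la T : cominuscule beta -> straight_shape la ->
  SYT la T -> evac T = evacuate toggle_on #|la| T.
Proof.
move=> hbeta hla hT; set V := evacuate _ _ _.
have hV : SYT la V.
  by apply: evacuate_ind hT => i U ik; apply: SYT_toggle.
have la_shape : #|shape T| = #|la| by have [-> _ _ _ _] := hT; rewrite setD0.
have mem_iter k x : k <= #|la| ->
    (x \in shape (iter (#|shape T| - k) (@jdt_erase _ _ _ beta) T)) =
    (0 < V x <= k).
  move=> kla; rewrite la_shape.
  have [U hU [-> VE]] := iter_jdt_erase hbeta hla hT kla.
  rewrite /V VE inE ffunE.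
  have -> : (0 < evacuate toggle_on k U x <= k) = (0 < U x <= k).
    pose P (W : filling beta) := (0 < W x <= k) = (0 < U x <= k).
    apply: (@evacuate_ind _ toggle_on P) => // i W ik; rewrite /P => <-.
    exact: toggle_lower_set.
  by case: (leqP (U x) k); rewrite ?andbT ?andbF ?lt0n.
apply/ffunP => x; rewrite ffunE.
have mem_k (k : 'I_#|shape T|) :
    (x \in shape (iter (#|shape T| - k.+1) (@jdt_erase _ _ _ beta) T)
      :\: shape (iter (#|shape T| - k) (@jdt_erase _ _ _ beta) T)) =
    (V x == k.+1).
  have kla : k < #|la| by rewrite -la_shape.
  by rewrite inE !mem_iter ?(ltnW kla) //; lia.
case: pickP => [k|noV]; first by rewrite mem_k => /eqP.
have [//|Vx] := posnP (V x).
have ltV : (V x).-1 < #|shape T| by rewrite la_shape prednK // (SYT_le hV).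
by have := noV (Ordinal ltV); rewrite mem_k /= prednK // eqxx.
Qed.

End Evacuation.

Theorem theorem4p1 (n : nat) (Phi : root_datum n) (D : root_base Phi)
    (beta : simple D) (hbeta : cominuscule beta)
    (la : {set box beta}) (hla : straight_shape la) :
  forall T : filling beta, SYT la T -> SYT la (evac T) /\ evac (evac T) = T.
Proof.
move=> T hT.
have hE : SYT la (evacuate (@toggle _ _ _ beta) #|la| T).
  by apply: evacuate_ind hT => i U ik; apply: SYT_toggle.
rewrite (evac_evacuate hbeta hla hT) (evac_evacuate hbeta hla hE).
split=> //; apply: evacuateK; first exact: toggleK.
by move=> i j U ij; apply: toggle_comm.
Qed.
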